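(* There exist a real number $K_0>1$ and a complex number $\varepsilon_0$ with $|\varepsilon_0|=1$ such that the transcendental entire function $$f_{K_0,\varepsilon_0}(z)=\sum_{n=0}^{\infty}\frac{\varepsilon_0^{n(n-1)/2}}{K_0^{n(n+1)/2}}\,z^n$$ satisfies $\beta(f_{K_0,\varepsilon_0})>0.58507$. Consequently, $B>0.58507$.
   Context: For an entire function $f(z)=\sum_{n=0}^{\infty}a_nz^n$ and $r>0$ put $M(r,f):=\max_{|z|=r}|f(z)|$ and $\mu(r,f):=\max_{n\ge 0}|a_n|r^n$. For a transcendental entire function $f$ (entire and not a polynomial) define $\beta(f):=\liminf_{r\to\infty}\frac{\mu(r,f)}{M(r,f)}$, and let $B:=\sup\{\beta(f): f\text{ is transcendental entire}\}$. *)

(* Defs.v *)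
From Stdlib Require Import Reals Lra Lia.
From Coquelicot Require Import Coquelicot.
Open Scope R_scope.

(* [C] carries several module structures in Coquelicot, one of them over [R];
   the scalars are fixed to [C] explicitly. *)
Definition is_power_series (a : nat -> C) (z l : C) : Prop :=
  @is_pseries C_AbsRing C_NormedModule a z l.

Definition entire (f : C -> C) : Prop :=
  forall z : C, @ex_derive C_AbsRing C_NormedModule f z.

Definition polynomial_function (f : C -> C) : Prop :=
  exists (N : nat) (c : nat -> C),
    forall z : C, f z = sum_n (fun k => (c k * z ^ k)%C) N.

Definition transcendental_entire (f : C -> C) : Prop :=
  entire f /\ ~ polynomial_function f.

Definition is_expansion (f : C -> C) (a : nat -> C) : Prop :=
  forall z : C, is_power_series a z (f z).

(* [iota P] is the unique object satisfying [P] when there is one; that the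
   coefficient is determined by [f] is [taylor_coef_eq] below. *)
Definition taylor_coef (f : C -> C) (n : nat) : C :=
  @iota C_CompleteNormedModule
    (fun c : C => exists a, is_expansion f a /\ c = a n).

(* For entire [f] and [r > 0] the maxima below are attained, and an attained
   maximum is this supremum: [max_of_eq]. *)
Definition max_of (E : R -> Prop) : R := real (Lub_Rbar E).

Definition max_modulus (r : R) (f : C -> C) : R :=
  max_of (fun y => exists z : C, Cmod z = r /\ y = Cmod (f z)).

Definition max_term (r : R) (f : C -> C) : R :=
  max_of (fun y => exists n : nat, y = Cmod (taylor_coef f n) * r ^ n).

(* liminf of [g r] as [r] tends to +oo: the supremum over [A] of the infimum
   of [g] on ]A, +oo[. Coquelicot only has [LimInf_seq]. *)
Definition LimInf_p_infty (g : R -> R) : Rbar :=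
  Rbar_lub (fun l => exists A : R,
    l = Glb_Rbar (fun y => exists r : R, A < r /\ y = g r)).

Definition beta (f : C -> C) : Rbar :=
  LimInf_p_infty (fun r => max_term r f / max_modulus r f).

Definition B : Rbar :=
  Rbar_lub (fun b => exists f, transcendental_entire f /\ b = beta f).

Definition coef_Keps (K : R) (eps : C) (n : nat) : C :=
  (eps ^ (n * (n - 1) / 2) / RtoC (K ^ (n * (n + 1) / 2))%R)%C.

(* The sum of the series; it converges for [1 < K] and [Cmod eps = 1]:
   [f_Keps_expansion]. *)
Definition f_Keps (K : R) (eps : C) (z : C) : C :=
  @iota C_CompleteNormedModule
    (fun l : C => is_power_series (coef_Keps K eps) z l).

Lemma max_of_eq (E : R -> Prop) (m : R) :
  E m -> (forall x, E x -> x <= m) -> max_of E = m.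
Proof.
intros Hm Hub; unfold max_of.
rewrite (is_lub_Rbar_unique E (Finite m)); [reflexivity|].
split.
- intros x Hx; apply Hub, Hx.
- intros b Hb; apply Hb, Hm.
Qed.

Lemma is_series_components (a : nat -> C) (l : C) :
  @is_series C_AbsRing C_NormedModule a l ->
  is_series (fun n => fst (a n)) (fst l) /\
  is_series (fun n => snd (a n)) (snd l).
Proof.
assert (Hs : forall n, sum_n (fun n => fst (a n)) n
             = fst (@sum_n C_NormedModule a n) /\
             sum_n (fun n => snd (a n)) n
             = snd (@sum_n C_NormedModule a n)).
{ induction n as [|n [IH1 IH2]].
  - rewrite !sum_O; split; reflexivity.
  - rewrite !sum_Sn, IH1, IH2; split; reflexivity. }
intros H; split.
- apply filterlim_ext with (fun n => fst (@sum_n C_NormedModule a n)).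
  { intros n; symmetry; apply Hs. }
  apply (filterlim_comp _ _ _ _ fst _ (locally l)); [exact H|].
  intros P [d Hd]; exists d; intros y [Hy _]; apply Hd, Hy.
- apply filterlim_ext with (fun n => snd (@sum_n C_NormedModule a n)).
  { intros n; symmetry; apply Hs. }
  apply (filterlim_comp _ _ _ _ snd _ (locally l)); [exact H|].
  intros P [d Hd]; exists d; intros y [_ Hy]; apply Hd, Hy.
Qed.

Lemma is_power_series_real (a : nat -> C) (x : R) (l : C) :
  is_power_series a (RtoC x) l ->
  is_pseries (fun n => fst (a n)) x (fst l) /\
  is_pseries (fun n => snd (a n)) x (snd l).
Proof.
assert (Hp : forall n, @pow_n C_Ring (RtoC x) n = RtoC (x ^ n)).
{ induction n as [|n IH]; [reflexivity|].
  simpl; rewrite IH; symmetry; apply RtoC_mult. }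
intros H; destruct (is_series_components _ _ H) as [H1 H2]; split.
- refine (is_series_ext _ _ _ _ H1); intros n; rewrite Hp.
  destruct (a n) as [u v].
  change (x ^ n * u - 0 * v = x ^ n * u); ring.
- refine (is_series_ext _ _ _ _ H2); intros n; rewrite Hp.
  destruct (a n) as [u v].
  change (x ^ n * v + 0 * u = x ^ n * v); ring.
Qed.

Lemma CV_radius_pos (a : nat -> R) : ex_pseries a 1 -> Rbar_lt 0 (CV_radius a).
Proof.
intros [l H].
destruct (Rbar_lt_dec (CV_radius a) 1) as [Hlt|Hge].
- exfalso; apply (CV_disk_outside a 1); [now rewrite Rabs_R1|].
  apply ex_series_lim_0; exists l.
  refine (is_series_ext _ _ _ _ H); intros n.
  change (1 ^ n * a n = a n * 1 ^ n); ring.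
- apply Rbar_lt_le_trans with 1; [apply Rlt_0_1|].
  now apply Rbar_not_lt_le.
Qed.

Lemma pseries_coef_unique (a b : nat -> R) :
  (forall x, exists l, is_pseries a x l /\ is_pseries b x l) ->
  forall n, a n = b n.
Proof.
intros H n; destruct (H 1) as [l [Ha Hb]].
apply PSeries_ext_recip.
- apply CV_radius_pos; now exists l.
- apply CV_radius_pos; now exists l.
- exists (mkposreal 1 Rlt_0_1); intros x _.
  destruct (H x) as [m [Hma Hmb]].
  now rewrite (is_pseries_unique _ _ _ Hma), (is_pseries_unique _ _ _ Hmb).
Qed.

Lemma is_expansion_unique (f : C -> C) (a b : nat -> C) :
  is_expansion f a -> is_expansion f b -> forall n, a n = b n.
Proof.
intros Ha Hb n; apply injective_projections.
- apply (pseries_coef_unique (fun n => fst (a n)) (fun n => fst (b n))).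
  intros x; exists (fst (f (RtoC x))).
  split; apply is_power_series_real; [apply Ha|apply Hb].
- apply (pseries_coef_unique (fun n => snd (a n)) (fun n => snd (b n))).
  intros x; exists (snd (f (RtoC x))).
  split; apply is_power_series_real; [apply Ha|apply Hb].
Qed.

Lemma taylor_coef_eq (f : C -> C) (a : nat -> C) :
  is_expansion f a -> forall n, taylor_coef f n = a n.
Proof.
intros Ha n; apply (@iota_unique C_AbsRing C_CompleteNormedModule).
- intros c [b [Hb ->]]; now apply (is_expansion_unique f).
- now exists a.
Qed.

Lemma Cmod_coef_Keps (K : R) (eps : C) (n : nat) :
  0 < K -> Cmod eps = 1 ->
  Cmod (coef_Keps K eps n) = / K ^ (n * (n + 1) / 2).
Proof.
intros HK He; unfold coef_Keps.
assert (Hp : 0 < K ^ (n * (n + 1) / 2)) by now apply pow_lt.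
rewrite Cmod_div, Cmod_pow, He, pow1, Cmod_R, Rabs_pos_eq.
- field; lra.
- lra.
- intros E; apply RtoC_inj in E; lra.
Qed.

Lemma coef_exponent_succ (n : nat) :
  (S n * (S n + 1) / 2 = n * (n + 1) / 2 + S n)%nat.
Proof.
replace (S n * (S n + 1))%nat with (n * (n + 1) + S n * 2)%nat by lia.
apply Nat.div_add; lia.
Qed.

Lemma f_Keps_expansion (K : R) (eps : C) :
  1 < K -> Cmod eps = 1 -> is_expansion (f_Keps K eps) (coef_Keps K eps).
Proof.
intros HK He z; unfold f_Keps, is_power_series.
assert (Hex : @ex_pseries C_AbsRing C_NormedModule (coef_Keps K eps) z).
{ set (s := Cmod z + 1).
  assert (Hs : 0 < s) by (pose proof (Cmod_ge_0 z); unfold s; lra).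
  pose (u := fun n => s ^ n * / K ^ (n * (n + 1) / 2)).
  assert (Hu : forall n, 0 < u n).
  { intros n; apply Rmult_lt_0_compat; [now apply pow_lt|].
    apply Rinv_0_lt_compat, pow_lt; lra. }
  apply (@ex_series_le C_AbsRing C_CompleteNormedModule) with u.
  - intros n.
    replace (@pow_n C_AbsRing z n) with (z ^ n)%C.
    2:{ induction n as [|n IH]; [reflexivity|]; simpl; now rewrite IH. }
    change (Cmod (z ^ n * coef_Keps K eps n) <= u n).
    rewrite Cmod_mult, Cmod_pow, Cmod_coef_Keps by (lra || exact He).
    apply Rmult_le_compat_r.
    + apply Rlt_le, Rinv_0_lt_compat, pow_lt; lra.
    + apply pow_incr; split; [apply Cmod_ge_0|unfold s; lra].
  - apply ex_series_ext with (fun n => Rabs (u n)).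
    { intros n; apply Rabs_pos_eq, Rlt_le, Hu. }
    apply ex_series_DAlembert with 0; [lra| |].
    { intros n; apply Rgt_not_eq, Hu. }
    apply is_lim_seq_ext with (fun n => s * (/ K) ^ (S n)).
    { intros n; rewrite Rabs_pos_eq.
      2:{ apply Rlt_le, Rdiv_lt_0_compat; apply Hu. }
      unfold u; rewrite coef_exponent_succ, pow_add, pow_inv.
      simpl (s ^ S n); field.
      repeat split; apply Rgt_not_eq; try (apply pow_lt); lra. }
    replace (Finite 0) with (Rbar_mult s 0) by (simpl; f_equal; ring).
    apply is_lim_seq_scal_l.
    apply (is_lim_seq_incr_1 (fun n => (/ K) ^ n)).
    apply is_lim_seq_geom; rewrite Rabs_pos_eq.
    + rewrite <- Rinv_1; apply Rinv_lt_contravar; lra.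
    + apply Rlt_le, Rinv_0_lt_compat; lra. }
destruct Hex as [l Hl].
replace (@iota C_CompleteNormedModule _) with l; [exact Hl|].
symmetry; apply (@iota_unique C_AbsRing C_CompleteNormedModule).
- intros y Hy.
  now apply (@filterlim_locally_unique nat C_AbsRing C_NormedModule eventually _
    (@sum_n C_NormedModule
       (fun k => @scal C_AbsRing C_NormedModule (@pow_n C_AbsRing z k)
          (coef_Keps K eps k)))).
- exact Hl.
Qed.

(* Main.v *)
(* Put q = eps / K. If K^n <= |z| <= K^(n+1), the term of index n is maximal, and
   f(z) divided by it is, up to tiny tails, the sum of the terms of index n - 4
   to n + 4; by a_(m+k) = a_m q^(m k) a_k this quotient depends on
   u = q^(n-4) z only, with K^4 <= |u| <= K^5. By the maximum principle on the
   annulus it suffices to bound it on the two boundary circles. There the terms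
   pair up into 2 |sum_j q^(j(j+1)/2) cos((2j+1)p)| with p real, the second
   circle being reduced to the first by f(z) = 1 + (z/K) f(q z). For
   q = (-41 + 44 i)/214 the square of the sum over j <= 3 is a polynomial of
   degree 7 in cos^2 p with rational coefficients, which is bounded on [0, 1]
   by an explicit certificate. *)

Require Import Defs.
From Stdlib Require Import Reals Lra Lia Psatz.
From Coquelicot Require Import Coquelicot.
Open Scope R_scope.

(** * Polynomials on circles and annuli *)

(** Indices run below [n], unlike in [sum_n], so that the empty sum exists and sums split along
    [m + n]. *)
Fixpoint Csum (u : nat -> C) (n : nat) : C :=
  match n with O => 0%C | S n => (Csum u n + u n)%C end.

Lemma Csum_ext (u v : nat -> C) (n : nat) :
  (forall k, (k < n)%nat -> u k = v k) -> Csum u n = Csum v n.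
Proof.
induction n as [|n IH]; intros H; [reflexivity|]; simpl.
rewrite IH by (intros; apply H; lia); rewrite H by lia; reflexivity.
Qed.

Lemma Csum_scal (c : C) (u : nat -> C) (n : nat) :
  Csum (fun k => c * u k)%C n = (c * Csum u n)%C.
Proof. induction n as [|n IH]; simpl; [ring|rewrite IH; ring]. Qed.

Lemma Csum_plus (u v : nat -> C) (n : nat) :
  Csum (fun k => u k + v k)%C n = (Csum u n + Csum v n)%C.
Proof. induction n as [|n IH]; simpl; [ring|rewrite IH; ring]. Qed.

Lemma Csum_add (u : nat -> C) (m n : nat) :
  Csum u (m + n) = (Csum u m + Csum (fun k => u (m + k)%nat) n)%C.
Proof.
induction n as [|n IH]; simpl.
- rewrite Nat.add_0_r; ring.
- rewrite Nat.add_succ_r; simpl; rewrite IH; ring.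
Qed.

Lemma Csum_even_odd (u : nat -> C) (n : nat) :
  Csum u (2 * n)
  = (Csum (fun k => u (2 * k)%nat) n + Csum (fun k => u (2 * k + 1)%nat) n)%C.
Proof.
induction n as [|n IH]; [simpl; ring|].
replace (2 * S n)%nat with (S (S (2 * n))) by lia.
cbn [Csum]; rewrite IH.
replace (S (2 * n)) with (2 * n + 1)%nat by lia; ring.
Qed.

Lemma Cmod_Csum_le (u : nat -> C) (M : R) (n : nat) :
  (forall k, (k < n)%nat -> Cmod (u k) <= M) -> Cmod (Csum u n) <= INR n * M.
Proof.
induction n as [|n IH]; intros H.
- simpl; rewrite Cmod_0; lra.
- rewrite S_INR; cbn [Csum].
  apply Rle_trans with (1 := Cmod_triangle _ _).
  assert (H1 := IH (fun k Hk => H k (Nat.lt_lt_succ_r _ _ Hk))).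
  assert (H2 := H n (Nat.lt_succ_diag_r n)); lra.
Qed.

(** Half-angle formulas: with [m = |w|] the root has parts [sqrt ((m + a) / 2)] and
    [sqrt ((m - a) / 2)], the second one taken with the sign of [b]. *)
Lemma Csqrt_exists (w : C) : exists u : C, (u * u)%C = w.
Proof.
destruct w as [a b].
set (m := sqrt (a * a + b * b)).
assert (Hm2 : m * m = a * a + b * b).
{ apply sqrt_sqrt; nra. }
assert (Hm : 0 <= m) by apply sqrt_pos.
assert (Ha : -m <= a <= m) by (split; nra).
set (x := sqrt ((m + a) / 2)); set (y := sqrt ((m - a) / 2)).
assert (Hx : x * x = (m + a) / 2) by (apply sqrt_sqrt; lra).
assert (Hy : y * y = (m - a) / 2) by (apply sqrt_sqrt; lra).
assert (Hx0 : 0 <= x) by apply sqrt_pos.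
assert (Hy0 : 0 <= y) by apply sqrt_pos.
assert (Hxy : (2 * x * y) * (2 * x * y) = b * b).
{ replace ((2 * x * y) * (2 * x * y)) with (4 * (x * x) * (y * y)) by ring.
  rewrite Hx, Hy; nra. }
assert (Hp : 0 <= x * y) by nra.
destruct (Rle_or_lt 0 b) as [Hb|Hb].
- exists (x, y); apply injective_projections; simpl; nra.
- exists (x, - y); apply injective_projections; simpl; nra.
Qed.

(* Cauchy's estimate. Splitting into even and odd parts halves the degree and
   squares the radius; both parts inherit the bound, through [p u + p (- u)] and
   [p u - p (- u)]. *)
Lemma coef_bound_pow2 (h : nat) (c : nat -> C) (r M : R) :
  0 < r ->
  (forall u, Cmod u = r -> Cmod (Csum (fun k => c k * u ^ k)%C (2 ^ h)) <= M) ->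
  forall k, (k < 2 ^ h)%nat -> Cmod (c k) * r ^ k <= M.
Proof.
revert c r M; induction h as [|h IH]; intros c r M Hr H k Hk.
{ simpl in Hk; replace k with O by lia.
  assert (H1 := H (RtoC r)); simpl in H1.
  rewrite Cmod_R, Rabs_pos_eq in H1 by lra.
  specialize (H1 eq_refl); simpl; rewrite Rmult_1_r.
  now replace (c O) with (0 + c O * 1)%C by ring. }
pose (E := fun w => Csum (fun k => c (2 * k)%nat * w ^ k)%C (2 ^ h)).
pose (O := fun w => Csum (fun k => c (2 * k + 1)%nat * w ^ k)%C (2 ^ h)).
assert (Hsplit : forall u, Csum (fun k => c k * u ^ k)%C (2 ^ S h)
                 = (E (u * u) + u * O (u * u))%C).
{ intros u; rewrite Nat.pow_succ_r', Csum_even_odd; unfold E, O; f_equal.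
  - apply Csum_ext; intros j _.
    rewrite Cpow_mult_r; do 2 f_equal; simpl; ring.
  - rewrite <- Csum_scal; apply Csum_ext; intros j _.
    rewrite Cpow_add_r, Cpow_mult_r, Cpow_1_r.
    replace (u ^ 2)%C with (u * u)%C by (simpl; ring); ring. }
assert (Hbd : forall w, Cmod w = r * r -> Cmod (E w) <= M /\ Cmod (O w) <= M / r).
{ intros w Hw; destruct (Csqrt_exists w) as [u Hu].
  assert (Hur : Cmod u = r).
  { rewrite <- Hu, Cmod_mult in Hw; pose proof (Cmod_ge_0 u); nra. }
  assert (H1 := H u Hur).
  assert (H2 := H (- u)%C); rewrite Cmod_opp in H2; specialize (H2 Hur).
  rewrite Hsplit in H1, H2.
  replace (- u * - u)%C with (u * u)%C in H2 by ring.
  rewrite Hu in H1, H2; split.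
  - assert (H3 : Cmod (RtoC 2 * E w) <= M + M).
    { replace (RtoC 2 * E w)%C with ((E w + u * O w) + (E w + - u * O w))%C by ring.
      apply Rle_trans with (1 := Cmod_triangle _ _); lra. }
    rewrite Cmod_mult, Cmod_R, Rabs_pos_eq in H3; lra.
  - assert (H3 : Cmod (RtoC 2 * (u * O w)) <= M + M).
    { replace (RtoC 2 * (u * O w))%C
        with ((E w + u * O w) + - (E w + - u * O w))%C by ring.
      apply Rle_trans with (1 := Cmod_triangle _ _); rewrite Cmod_opp; lra. }
    rewrite Cmod_mult, Cmod_R, Rabs_pos_eq, Cmod_mult, Hur in H3 by lra.
    apply Rmult_le_reg_l with (1 := Hr).
    replace (r * (M / r)) with M by (field; lra); lra. }
assert (Hrr : 0 < r * r) by nra.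
rewrite Nat.pow_succ_r' in Hk.
destruct (Nat.Even_or_Odd k) as [[j ->]|[j ->]].
- assert (H1 := IH _ _ _ Hrr (fun w Hw => proj1 (Hbd w Hw)) j ltac:(lia)).
  rewrite pow_mult; replace (r ^ 2) with (r * r) by ring; exact H1.
- assert (H1 := IH _ _ _ Hrr (fun w Hw => proj2 (Hbd w Hw)) j ltac:(lia)).
  rewrite pow_add, pow_mult; replace (r ^ 2) with (r * r) by ring.
  apply (Rmult_le_compat_l r) in H1; [|lra].
  replace (r * (M / r)) with M in H1 by (field; lra).
  simpl (r ^ 1); cbv beta in H1; lra.
Qed.

(** Padding with zero coefficients up to length [2 ^ D], which exceeds [D], reduces this to the
    dyadic case. *)
Lemma coef_bound (D : nat) (c : nat -> C) (r M : R) :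
  0 < r ->
  (forall u, Cmod u = r -> Cmod (Csum (fun k => c k * u ^ k)%C D) <= M) ->
  forall k, (k < D)%nat -> Cmod (c k) * r ^ k <= M.
Proof.
intros Hr H k Hk.
pose (c' := fun k => if (k <? D)%nat then c k else 0%C).
assert (HD : (D < 2 ^ D)%nat) by (apply Nat.pow_gt_lin_r; lia).
replace (c k) with (c' k).
2:{ unfold c'; now rewrite (proj2 (Nat.ltb_lt _ _) Hk). }
apply coef_bound_pow2 with (h := D); [exact Hr| |lia].
intros u Hu.
replace (2 ^ D)%nat with (D + (2 ^ D - D))%nat by lia.
rewrite Csum_add, (Csum_ext _ (fun k => c k * u ^ k)%C).
2:{ intros j Hj; unfold c'; now rewrite (proj2 (Nat.ltb_lt _ _) Hj). }
rewrite (Csum_ext _ (fun k => 0 * 0)%C (2 ^ D - D)).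
2:{ intros j Hj; unfold c'; rewrite (proj2 (Nat.ltb_ge _ _)) by lia; ring. }
rewrite Csum_scal, Cmult_0_l, Cplus_0_r; now apply H.
Qed.

(** The coefficients stay existential: those of a power of [p] matter only through the bounds that
    [coef_bound] gives. *)
Definition poly_below (D : nat) (p : C -> C) : Prop :=
  exists c : nat -> C, forall z, p z = Csum (fun k => c k * z ^ k)%C D.

Lemma poly_below_weaken (D E : nat) (p : C -> C) :
  (D <= E)%nat -> poly_below D p -> poly_below E p.
Proof.
intros HDE [c Hc].
exists (fun k => if (k <? D)%nat then c k else 0%C); intros z; rewrite Hc.
replace E with (D + (E - D))%nat by lia; rewrite Csum_add.
rewrite (Csum_ext _ (fun k => 0 * 0)%C (E - D)).
2:{ intros j Hj; rewrite (proj2 (Nat.ltb_ge _ _)) by lia; ring. }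
rewrite Csum_scal, Cmult_0_l, Cplus_0_r.
apply Csum_ext; intros j Hj; now rewrite (proj2 (Nat.ltb_lt _ _) Hj).
Qed.

Lemma poly_below_plus (D : nat) (p r : C -> C) :
  poly_below D p -> poly_below D r -> poly_below D (fun z => p z + r z)%C.
Proof.
intros [c Hc] [d Hd]; exists (fun k => c k + d k)%C; intros z.
rewrite Hc, Hd, <- Csum_plus; apply Csum_ext; intros; ring.
Qed.

Lemma poly_below_monomial_mult (D n : nat) (a : C) (p : C -> C) :
  poly_below D p -> poly_below (n + D) (fun z => a * z ^ n * p z)%C.
Proof.
intros [c Hc].
exists (fun k => if (k <? n)%nat then RtoC 0 else (a * c (k - n)%nat)%C); intros z.
rewrite Csum_add, (Csum_ext _ (fun k => 0 * 0)%C n).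
2:{ intros j Hj; rewrite (proj2 (Nat.ltb_lt _ _)) by lia; ring. }
rewrite Csum_scal, Cmult_0_l, Cplus_0_l, Hc, <- Csum_scal.
apply Csum_ext; intros j Hj.
rewrite (proj2 (Nat.ltb_ge _ _)) by lia.
replace (n + j - n)%nat with j by lia; rewrite Cpow_add_r; ring.
Qed.

Lemma poly_below_mult (D E : nat) (p r : C -> C) :
  poly_below D p -> poly_below E r -> poly_below (D + E) (fun z => p z * r z)%C.
Proof.
intros [c Hc] Hr.
(* Writing the first factor as an explicit sum allows an induction on [D] that peels off its top
   monomial. *)
assert (H : poly_below (D + E) (fun z => Csum (fun k => c k * z ^ k) D * r z)%C).
{ clear p Hc; induction D as [|D IH].
  - exists (fun _ => 0%C); intros z; rewrite Csum_scal; simpl; ring.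
  - destruct (poly_below_plus (S D + E) _ _
      (poly_below_weaken (D + E) (S D + E) _ ltac:(lia) IH)
      (poly_below_weaken (D + E) (S D + E) _ ltac:(lia)
         (poly_below_monomial_mult E D (c D) r Hr))) as [d Hd].
    exists d; intros z; rewrite <- Hd; cbn [Csum]; ring. }
destruct H as [d Hd]; exists d; intros z; now rewrite Hc, Hd.
Qed.

Lemma poly_below_pow (D n : nat) (p : C -> C) :
  poly_below D p -> poly_below (n * D + 1) (fun z => p z ^ n)%C.
Proof.
intros Hp; induction n as [|n IH].
- exists (fun _ => 1%C); intros z; simpl; ring.
- destruct (poly_below_mult _ _ _ _ Hp IH) as [c Hc].
  replace (S n * D + 1)%nat with (D + (n * D + 1))%nat by lia.
  exists c; intros z; rewrite <- Hc; reflexivity.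
Qed.

(** If [x = 1 + h] with [h > 0], Bernoulli's inequality gives [(1 + n h) ^ 2 <= x ^ (2 n)], and the
    left side exceeds [A (2 n + 1)] once [n h ^ 2 > 3 A]. *)
Lemma pow_linear_bound (x A : R) :
  (forall n : nat, x ^ n <= A * INR (n + 1)) -> x <= 1.
Proof.
intros H; destruct (Rle_or_lt x 1) as [Hx|Hx]; [exact Hx|exfalso].
set (h := x - 1).
assert (Hh : 0 < h) by (unfold h; lra).
assert (HA : 1 <= A) by (specialize (H O); simpl in H; lra).
destruct (INR_unbounded (3 * A / (h * h) + 1)) as [n Hn].
assert (Hn1 : 1 < INR n).
{ assert (0 < 3 * A / (h * h)) by (apply Rdiv_lt_0_compat; nra); lra. }
assert (HhA : 3 * A < INR n * (h * h)).
{ assert (3 * A / (h * h) < INR n) by lra.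
  apply (Rmult_lt_compat_r (h * h)) in H0; [|nra].
  replace (3 * A / (h * h) * (h * h)) with (3 * A) in H0 by (field; lra); lra. }
assert (Hb : 1 + INR n * h <= x ^ n).
{ replace x with (1 + h) by (unfold h; ring); now apply poly. }
specialize (H (n + n)%nat); rewrite pow_add, !plus_INR in H.
simpl in H.
assert (Hy : 0 < INR n * h) by (apply Rmult_lt_0_compat; lra).
assert (Hsq : (1 + INR n * h) * (1 + INR n * h) <= x ^ n * x ^ n)
  by (apply Rmult_le_compat; lra).
apply (Rmult_lt_compat_r (INR n)) in HhA; [|lra].
assert (A <= A * INR n) by nra.
lra.
Qed.

(* Landau's power trick: the coefficient bounds on the two circles give the
   estimate up to the factor [D]; applied to [p ^ n], whose degree grows only
   linearly, they give it up to [(n * D + 1) ^ (1 / n)], which tends to 1. *)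
Lemma annulus_maximum_principle (D a : nat) (p : C -> C) (r1 r2 M : R) :
  0 < r1 -> 0 < M -> poly_below D p ->
  (forall u, Cmod u = r1 -> Cmod (p u) <= M * r1 ^ a) ->
  (forall u, Cmod u = r2 -> Cmod (p u) <= M * r2 ^ a) ->
  forall z, r1 <= Cmod z <= r2 -> Cmod (p z) <= M * Cmod z ^ a.
Proof.
intros Hr1 HM Hp H1 H2 z Hz; set (r := Cmod z) in *.
assert (Hpow : forall n : nat, Cmod (p z) ^ n <= INR (n * D + 1) * (M * r ^ a) ^ n).
{ intros n; destruct (poly_below_pow D n p Hp) as [c Hc].
  assert (Hcirc : forall rho, 0 < rho ->
    (forall u, Cmod u = rho -> Cmod (p u) <= M * rho ^ a) ->
    forall k, (k < n * D + 1)%nat ->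
      Cmod (c k) * rho ^ k <= M ^ n * rho ^ (a * n)).
  { intros rho Hrho H; apply coef_bound; [exact Hrho|]; intros u Hu.
    rewrite <- Hc, Cmod_pow, pow_mult, <- Rpow_mult_distr.
    apply pow_incr; split; [apply Cmod_ge_0|now apply H]. }
  rewrite <- Cmod_pow, Hc; apply Cmod_Csum_le; intros k Hk.
  rewrite Cmod_mult, Cmod_pow; fold r.
  rewrite Rpow_mult_distr, <- pow_mult.
  assert (Hr : 0 < r) by lra.
  assert (Hn := pow_le _ n (Rlt_le _ _ HM)).
  (* Relative to [r ^ (a n)], a monomial of index at least [a n] grows with the radius, so the outer
     circle controls it; the inner circle controls the others. *)
  destruct (Nat.le_gt_cases (a * n) k) as [Hak|Hak].
  - assert (Hk2 := Hcirc r2 ltac:(lra) H2 k Hk).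
    replace k with (a * n + (k - a * n))%nat in Hk2 |- * by lia.
    set (j := (k - a * n)%nat) in *.
    rewrite pow_add in Hk2 |- *.
    assert (0 < r2 ^ (a * n)) by (apply pow_lt; lra).
    assert (Hj : Cmod (c (a * n + j)%nat) * r2 ^ j <= M ^ n).
    { apply Rmult_le_reg_r with (1 := H); lra. }
    assert (Hrj : r ^ j <= r2 ^ j) by (apply pow_incr; lra).
    assert (Hran := pow_lt r (a * n) Hr).
    assert (Hc0 := Cmod_ge_0 (c (a * n + j)%nat)).
    assert (Cmod (c (a * n + j)%nat) * r ^ j <= M ^ n) by nra.
    nra.
  - assert (Hk2 := Hcirc r1 ltac:(lra) H1 k Hk).
    replace (a * n)%nat with (k + (a * n - k))%nat in Hk2 |- * by lia.
    set (j := (a * n - k)%nat) in *.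
    rewrite pow_add in Hk2 |- *.
    assert (0 < r1 ^ k) by (apply pow_lt; lra).
    assert (Hj : Cmod (c k) <= M ^ n * r1 ^ j).
    { apply Rmult_le_reg_r with (1 := H); lra. }
    assert (Hrj : r1 ^ j <= r ^ j) by (apply pow_incr; lra).
    assert (Hran := pow_lt r k Hr).
    assert (Cmod (c k) <= M ^ n * r ^ j) by nra.
    nra. }
assert (Hpos : 0 < M * r ^ a) by (apply Rmult_lt_0_compat; [|apply pow_lt]; lra).
assert (Hq : Cmod (p z) / (M * r ^ a) <= 1).
(* The factor [n * D + 1] is at most [(D + 1) * (n + 1)]. *)
{ apply pow_linear_bound with (INR (D + 1)); intros n.
  unfold Rdiv; rewrite Rpow_mult_distr, pow_inv.
  assert (Hn := pow_lt _ n Hpos).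
  apply Rmult_le_reg_r with (1 := Hn).
  rewrite Rmult_assoc, Rinv_l, Rmult_1_r by lra.
  apply Rle_trans with (1 := Hpow n), Rmult_le_compat_r; [lra|].
  rewrite <- mult_INR; apply le_INR; nia. }
apply Rmult_le_reg_r with (/ (M * r ^ a)); [now apply Rinv_0_lt_compat|].
rewrite Rinv_r by lra; exact Hq.
Qed.

(** * The central terms of the series *)

Lemma coef_Keps_eq (K : R) (eps : C) (k : nat) :
  0 < K ->
  coef_Keps K eps k = ((eps / K) ^ (k * (k - 1) / 2) / RtoC K ^ k)%C.
Proof.
intros HK.
assert (HK0 : RtoC K <> 0%C) by (intros E; apply RtoC_inj in E; lra).
assert (Hexp : (k * (k + 1) / 2 = k * (k - 1) / 2 + k)%nat).
{ rewrite <- Nat.div_add by lia; f_equal; destruct k; nia. }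
unfold coef_Keps; rewrite Hexp, RtoC_pow, Cpow_add_r.
replace eps with (eps / K * K)%C at 1 by (field; exact HK0).
rewrite Cpow_mult_l; field; repeat split; now apply Cpow_nz.
Qed.

(** The exponent [k (k - 1) / 2] of [q = eps / K] is quadratic in the index, whence the mixed factor
    [q ^ (m k)]. *)
Lemma coef_Keps_add (K : R) (eps : C) (m k : nat) :
  0 < K ->
  coef_Keps K eps (m + k)
  = (coef_Keps K eps m * ((eps / K) ^ m) ^ k * coef_Keps K eps k)%C.
Proof.
intros HK.
assert (HK0 : RtoC K <> 0%C) by (intros E; apply RtoC_inj in E; lra).
rewrite !coef_Keps_eq by exact HK.
replace ((m + k) * (m + k - 1) / 2)%nat
  with (m * (m - 1) / 2 + m * k + k * (k - 1) / 2)%nat.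
(* Evenness of [j (j - 1)] makes the integer divisions by 2 exact. *)
2:{ assert (He : forall j, exists i, (j * (j - 1) = i * 2)%nat).
    { intros j; destruct (Nat.Even_or_Odd j) as [[i ->]|[i ->]].
      - exists (i * (2 * i - 1))%nat; nia.
      - exists ((2 * i + 1) * i)%nat; nia. }
    destruct (He m) as [i Hi]; destruct (He k) as [j Hj].
    replace ((m + k) * (m + k - 1))%nat with ((i + m * k + j) * 2)%nat.
    - now rewrite Hi, Hj, !Nat.div_mul.
    - destruct m, k; nia. }
rewrite !Cpow_add_r, Cpow_mult_r; field; split; now apply Cpow_nz.
Qed.

(** The functional equation [f(z) = 1 + (z / K) f(q z)], read off on coefficients. *)
Lemma coef_Keps_succ (K : R) (eps : C) (k : nat) :
  0 < K ->
  coef_Keps K eps (S k) = (coef_Keps K eps k * (eps / K) ^ k / K)%C.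
Proof.
intros HK; rewrite <- Nat.add_1_r, coef_Keps_add, Cpow_1_r by exact HK.
rewrite (coef_Keps_eq K eps 1), Cpow_1_r by exact HK.
change (1 * (1 - 1) / 2)%nat with O; change ((eps / K) ^ 0)%C with (RtoC 1).
field; intros E; apply RtoC_inj in E; lra.
Qed.

(* [2 (cos p + q cos 3p + q^3 cos 5p + q^6 cos 7p)] in terms of [tau = 2 cos p]. *)
Definition cos_sum (q tau : C) : C :=
  (tau + q * (tau ^ 3 - 3 * tau) + q ^ 3 * (tau ^ 5 - 5 * tau ^ 3 + 5 * tau)
   + q ^ 6 * (tau ^ 7 - 7 * tau ^ 5 + 14 * tau ^ 3 - 7 * tau))%C.

Lemma Cmod_1_plus_inv (e : C) :
  Cmod e = 1 -> exists t : R, (e + / e)%C = RtoC t /\ -2 <= t <= 2.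
Proof.
intros He; exists (2 * Re e).
assert (H2 : fst e * fst e + snd e * snd e = 1).
{ unfold Cmod in He; apply (f_equal (fun x => x * x)) in He.
  rewrite sqrt_sqrt in He; nra. }
split.
- destruct e as [x y]; simpl in *; apply injective_projections; simpl;
    replace (x * (x * 1) + y * (y * 1)) with 1 by lra; field.
- unfold Re; nra.
Qed.

Lemma Cmod_eps_div_K (K : R) (eps : C) :
  0 < K -> Cmod eps = 1 -> Cmod (eps / K) = / K.
Proof.
intros HK He; rewrite Cmod_div, He, Cmod_R, Rabs_pos_eq; [field; lra|lra|].
intros E; apply RtoC_inj in E; lra.
Qed.

(* On this circle the terms of index [3 - j] and [4 + j] have the same modulus;
   writing [q ^ 3 u / K = e ^ 2], [e = exp (i p)], their sum is
   [2 q ^ (j (j + 1) / 2) cos ((2 j + 1) p)] times [e ^ 7 / q ^ 6]. *)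
Lemma eight_terms_bound (K c : R) (eps u : C) :
  0 < K -> Cmod eps = 1 ->
  (forall t : R, -2 <= t <= 2 -> Cmod (cos_sum (eps / K) t) <= c) ->
  Cmod u = K ^ 4 ->
  Cmod (Csum (fun k => coef_Keps K eps k * u ^ k)%C 8) <= c * K ^ 6.
Proof.
intros HK He Hc Hu; assert (Hq := Cmod_eps_div_K K eps HK He).
assert (HK0 : RtoC K <> 0%C) by (intros E; apply RtoC_inj in E; lra).
set (q := (eps / K)%C) in *.
destruct (Csqrt_exists (q ^ 3 * u / K)%C) as [e Hee].
assert (He1 : Cmod e = 1).
{ assert (H : Cmod e * Cmod e = 1).
  { rewrite <- Cmod_mult, Hee, Cmod_div by exact HK0.
    rewrite Cmod_mult, Cmod_pow, Hq, Hu, Cmod_R, Rabs_pos_eq by lra.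
    field; lra. }
  pose proof (Cmod_ge_0 e); nra. }
assert (He0 : e <> 0%C).
{ intros E; rewrite E, Cmod_0 in He1; lra. }
destruct (Cmod_1_plus_inv e He1) as [t [Ht Ht2]].
assert (Hid : (q ^ 6 * Csum (fun k => coef_Keps K eps k * u ^ k) 8
               = e ^ 7 * cos_sum q t)%C).
(* The term of index [k], multiplied by [q ^ 6], is [q ^ ((k - 3) (k - 4) / 2)] times
   [(q ^ 3 u / K) ^ k]; this exponent is symmetric about [k = 7/2]. *)
{ transitivity (q ^ 6 + q ^ 3 * (e * e) + q * (e * e) ^ 2 + (e * e) ^ 3
    + (e * e) ^ 4 + q * (e * e) ^ 5 + q ^ 3 * (e * e) ^ 6
    + q ^ 6 * (e * e) ^ 7)%C.
  - rewrite Hee; cbn [Csum]; rewrite !coef_Keps_eq by exact HK; fold q.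
    simpl (_ / _)%nat; field; exact HK0.
  - rewrite <- Ht; unfold cos_sum; field; exact He0. }
apply (f_equal Cmod) in Hid.
rewrite !Cmod_mult, !Cmod_pow, He1, Hq, pow1, Rmult_1_l, pow_inv in Hid.
assert (HK6 : 0 < K ^ 6) by now apply pow_lt.
assert (H := Hc t Ht2); rewrite <- Hid in H.
apply (Rmult_le_compat_r (K ^ 6)) in H; [|lra].
rewrite (Rmult_comm (/ K ^ 6)), Rmult_assoc, Rinv_l, Rmult_1_r in H; lra.
Qed.

(** Here [K ^ (-10) |u| ^ 4] is the modulus of the term of index 4. On each boundary circle one term
    is split off, index 8 on the inner and index 0 on the outer one; its modulus is [K ^ (-10)]
    times that of the term of index 4, and the other eight pair up. *)
Lemma nine_terms_bound (K c : R) (eps u : C) :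
  1 < K -> Cmod eps = 1 ->
  (forall t : R, -2 <= t <= 2 -> Cmod (cos_sum (eps / K) t) <= c) ->
  K ^ 4 <= Cmod u <= K ^ 5 ->
  Cmod (Csum (fun k => coef_Keps K eps k * u ^ k)%C 9)
  <= (c + / K ^ 10) * / K ^ 10 * Cmod u ^ 4.
Proof.
intros HK He Hc Hu.
assert (Hc0 : 0 <= c).
{ apply Rle_trans with (2 := Hc 0 ltac:(lra)), Cmod_ge_0. }
assert (HK0 : RtoC K <> 0%C) by (intros E; apply RtoC_inj in E; lra).
assert (Hq := Cmod_eps_div_K K eps ltac:(lra) He).
assert (Hi : 0 < / K ^ 10) by (apply Rinv_0_lt_compat, pow_lt; lra).
apply annulus_maximum_principle
  with (D := 9%nat) (r1 := K ^ 4) (r2 := K ^ 5)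
       (p := fun u => Csum (fun k => coef_Keps K eps k * u ^ k)%C 9).
- apply pow_lt; lra.
- apply Rmult_lt_0_compat; lra.
- now exists (coef_Keps K eps).
- clear u Hu; intros u Hu; change (Csum ?f 9) with (Csum f 8 + f 8%nat)%C; cbv beta.
  apply Rle_trans with (1 := Cmod_triangle _ _).
  replace ((c + / K ^ 10) * / K ^ 10 * (K ^ 4) ^ 4) with (c * K ^ 6 + / K ^ 4)
    by (field; lra).
  apply Rplus_le_compat; [now apply eight_terms_bound; try lra|].
  apply Req_le; rewrite Cmod_mult, Cmod_coef_Keps, Cmod_pow, Hu by lra.
  simpl (_ / _)%nat; field; lra.
(* The terms of index 1 to 8 at [u] are [u / K] times those of index 0 to 7 at [q u], and [q u] lies
   on the inner circle. *)
- clear u Hu; intros u Hu; change (Csum ?f 9) with (Csum f (1 + 8)); rewrite Csum_add.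
  rewrite (Csum_ext (fun k => coef_Keps K eps (1 + k) * u ^ (1 + k))%C
    (fun k => (u / K) * (coef_Keps K eps k * (eps / K * u) ^ k))%C).
  2:{ intros k _; simpl (1 + k)%nat; rewrite coef_Keps_succ by lra.
      rewrite Cpow_mult_l, Cpow_S; field; exact HK0. }
  rewrite Csum_scal.
  apply Rle_trans with (1 := Cmod_triangle _ _).
  replace ((c + / K ^ 10) * / K ^ 10 * (K ^ 5) ^ 4) with (1 + K ^ 4 * (c * K ^ 6))
    by (field; lra).
  apply Rplus_le_compat.
  + apply Req_le; cbn [Csum].
    rewrite Cplus_0_l, Cmod_mult, Cmod_coef_Keps, Cmod_pow by lra.
    simpl; field.
  + rewrite Cmod_mult, Cmod_div, Hu, Cmod_R, Rabs_pos_eq by (lra || exact HK0).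
    replace (K ^ 5 / K) with (K ^ 4) by (field; lra).
    apply Rmult_le_compat_l; [apply pow_le; lra|].
    apply eight_terms_bound; try assumption; try lra.
    rewrite Cmod_mult, Hq, Hu; field; lra.
- exact Hu.
Qed.

(** * The cosine sum at one explicit parameter *)

Lemma Cmod_le_of_sqr (z : C) (c : R) :
  0 <= c -> fst z * fst z + snd z * snd z <= c * c -> Cmod z <= c.
Proof.
intros Hc H; unfold Cmod; rewrite <- (sqrt_square c Hc).
apply sqrt_le_1_alt; simpl; lra.
Qed.

(* Found by numerical optimization of the maximum of [cos_sum q]. *)
Definition q0 : C := (-41 / 214, 44 / 214).

(* The difference of the two sides is almost zero at [X = 1] and, quadratically,
   near [X = 7/11]; hence it is sought in the form
   [g + (1 - X) (h + h' (X - 7/11) + (X - 7/11) ^ 2 H X)], where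
   [h + h' y + 1000 h y ^ 2] is positive (here [h' = 50 h]) and [H] has positive Bernstein
   coefficients of degree 4. *)
Lemma cos_sum_sqr_bound (X : R) :
  0 <= X <= 1 ->
  let T1 := 4 * X - 3 in
  let T2 := 16 * X ^ 2 - 20 * X + 5 in
  let T3 := 64 * X ^ 3 - 112 * X ^ 2 + 56 * X - 7 in
  4 * X * ((1 + -41 / 214 * T1 + 169207 / 9800344 * T2
              + 9941931585 / 96046742518336 * T3) ^ 2
           + (44 / 214 * T1 + 136708 / 9800344 * T2
              + 46263901112 / 96046742518336 * T3) ^ 2)
  <= (17091877 / 10000000) ^ 2.
Proof.
intros HX; cbv zeta.
assert (H1 : 0 <= (1 - X) * (1 + 50 * (X - 7 / 11) + 1000 * (X - 7 / 11) ^ 2)).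
{ apply Rmult_le_pos; [lra|].
  (* With [y = X - 7/11], the quadratic factor is [(1 + 25 y) ^ 2 + 375 y ^ 2]. *)
  assert (H := pow2_ge_0 (1 + 25 * (X - 7 / 11))).
  assert (H' := pow2_ge_0 (X - 7 / 11)); lra. }
assert (HB : forall i j, 0 <= (1 - X) * (X - 7 / 11) ^ 2 * (X ^ i * (1 - X) ^ j)).
{ intros i j; apply Rmult_le_pos; [apply Rmult_le_pos|apply Rmult_le_pos].
  - lra.
  - apply pow2_ge_0.
  - apply pow_le; lra.
  - apply pow_le; lra. }
assert (B0 := HB 0%nat 4%nat); assert (B1 := HB 1%nat 3%nat).
assert (B2 := HB 2%nat 2%nat); assert (B3 := HB 3%nat 1%nat).
assert (B4 := HB 4%nat 0%nat); clear HB.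
lra.
Qed.

Lemma cos_sum_q0_bound (t : R) :
  -2 <= t <= 2 -> Cmod (cos_sum q0 t) <= 17091877 / 10000000.
Proof.
intros Ht; apply Cmod_le_of_sqr; [lra|].
(* For [t = 2 cos p] this is [cos^2 p], and [T1], [T2], [T3] are the quotients of [cos 3p],
   [cos 5p], [cos 7p] by [cos p]. *)
pose (X := t * t / 4).
assert (HX : 0 <= X <= 1) by (unfold X; split; nra).
assert (Hq3 : (q0 ^ 3)%C = (169207 / 9800344, 136708 / 9800344)).
{ apply injective_projections; unfold q0; simpl; field. }
assert (Hq6 : (q0 ^ 6)%C
              = (9941931585 / 96046742518336, 46263901112 / 96046742518336)).
{ replace (q0 ^ 6)%C with (q0 ^ 3 * q0 ^ 3)%C by ring; rewrite Hq3.
  apply injective_projections; simpl; field. }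
replace (17091877 / 10000000 * (17091877 / 10000000))
  with ((17091877 / 10000000) ^ 2) by ring.
apply Rle_trans with (2 := cos_sum_sqr_bound X HX).
apply Req_le; unfold cos_sum; rewrite Hq3, Hq6; unfold X, q0; simpl; field.
Qed.

(** * Size of the terms, remainder of the series *)

Lemma sum_n_Csum (u : nat -> C) (n : nat) :
  @sum_n C_NormedModule u n = Csum u (S n).
Proof.
induction n as [|n IH].
- rewrite sum_O; simpl; ring.
- rewrite sum_Sn, IH; reflexivity.
Qed.

Lemma series_remainder_le (u : nat -> C) (l c : C) (M : R) (N : nat) :
  @is_series C_AbsRing C_NormedModule u l ->
  (forall i, Cmod (Csum u (N + i) - c) <= M) -> Cmod (l - c) <= M.
Proof.
intros Hl H; apply le_epsilon; intros e He.
destruct (proj1 (filterlim_locally_ball_norm _ _) Hl (mkposreal e He)) as [n0 Hn0].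
assert (H0 := Hn0 (N + n0)%nat ltac:(lia)).
unfold ball_norm in H0; rewrite sum_n_Csum in H0.
change (Cmod (Csum u (S (N + n0)) - l) < e) in H0.
replace (S (N + n0)) with (N + S n0)%nat in H0 by lia.
specialize (H (S n0)).
replace (l - c)%C with ((Csum u (N + S n0) - c) + - (Csum u (N + S n0) - l))%C
  by ring.
apply Rle_trans with (1 := Cmod_triangle _ _); rewrite Cmod_opp; lra.
Qed.

Lemma pow_n_Cpow (z : C) (n : nat) : @pow_n C_AbsRing z n = (z ^ n)%C.
Proof. induction n as [|n IH]; [reflexivity|]; simpl; now rewrite IH. Qed.

Lemma power_series_is_series (a : nat -> C) (z l : C) :
  is_power_series a z l ->
  @is_series C_AbsRing C_NormedModule (fun k => a k * z ^ k)%C l.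
Proof.
intros H; refine (is_series_ext _ _ _ _ H); intros k.
rewrite pow_n_Cpow; change ((z ^ k * a k)%C = (a k * z ^ k)%C); ring.
Qed.

(* The modulus of the term of index [k] of [f_Keps K eps z], for [Cmod z = r]. *)
Definition term (K r : R) (k : nat) : R := / K ^ (k * (k + 1) / 2) * r ^ k.

Lemma term_pos (K r : R) (k : nat) : 0 < K -> 0 < r -> 0 < term K r k.
Proof.
intros HK Hr; apply Rmult_lt_0_compat; [apply Rinv_0_lt_compat|];
  now apply pow_lt.
Qed.

Lemma term_succ (K r : R) (k : nat) :
  0 < K -> term K r (S k) * K ^ S k = term K r k * r.
Proof.
intros HK; unfold term; rewrite coef_exponent_succ, pow_add.
assert (0 < K ^ (k * (k + 1) / 2)) by now apply pow_lt.
assert (0 < K ^ S k) by now apply pow_lt.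
rewrite <- (tech_pow_Rmult r k); field; lra.
Qed.

(** The ratio of consecutive terms is [r / K ^ (k + 1)], here at least [K ^ (n - k - 1)]. The
    parameter [i] selects the gain: 0 for monotonicity, 5 for comparison with a geometric series. *)
Lemma term_grows (K r : R) (n k i : nat) :
  1 < K -> K ^ n <= r -> (S k + i <= n)%nat ->
  term K r k * K ^ i <= term K r (S k).
Proof.
intros HK Hr Hk.
assert (H := term_succ K r k ltac:(lra)).
assert (Hp : 0 < K ^ S k) by (apply pow_lt; lra).
assert (Hi : 0 < K ^ i) by (apply pow_lt; lra).
assert (Hle : K ^ S k * K ^ i <= r).
{ rewrite <- pow_add; apply Rle_trans with (2 := Hr), Rle_pow; [lra|lia]. }
assert (Ht := term_pos K r k ltac:(lra) ltac:(nra)).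
apply Rmult_le_reg_r with (1 := Hp); rewrite H; nra.
Qed.

Lemma term_decays (K r : R) (n k i : nat) :
  1 < K -> 0 < r <= K ^ S n -> (n + i <= k)%nat ->
  term K r (S k) * K ^ i <= term K r k.
Proof.
intros HK Hr Hk.
assert (H := term_succ K r k ltac:(lra)).
assert (Hp : 0 < K ^ S k) by (apply pow_lt; lra).
assert (Hi : 0 < K ^ i) by (apply pow_lt; lra).
assert (Hle : r * K ^ i <= K ^ S k).
{ apply Rle_trans with (K ^ S n * K ^ i); [nra|].
  rewrite <- pow_add; apply Rle_pow; [lra|lia]. }
assert (Ht := term_pos K r k ltac:(lra) ltac:(lra)).
apply Rmult_le_reg_r with (1 := Hp); nra.
Qed.

Lemma term_max (K r : R) (n k : nat) :
  1 < K -> K ^ n <= r <= K ^ S n -> term K r k <= term K r n.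
Proof.
intros HK Hr; assert (Hn : 0 < K ^ n) by (apply pow_lt; lra).
destruct (Nat.le_gt_cases k n) as [H|H].
- replace k with (n - (n - k))%nat by lia.
  induction (n - k)%nat as [|j IH]; [rewrite Nat.sub_0_r; lra|].
  (* Once [j] reaches [n], truncated subtraction keeps the index at 0. *)
  destruct (Nat.le_gt_cases n j) as [Hj|Hj].
  { now replace (n - S j)%nat with (n - j)%nat by lia. }
  apply Rle_trans with (2 := IH).
  assert (H1 := term_grows K r n (n - S j) 0 HK (proj1 Hr) ltac:(lia)).
  replace (S (n - S j)) with (n - j)%nat in H1 by lia; simpl in H1; lra.
- replace k with (n + (k - n))%nat by lia.
  induction (k - n)%nat as [|j IH]; [rewrite Nat.add_0_r; lra|].
  apply Rle_trans with (2 := IH).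
  assert (H1 := term_decays K r n (n + j) 0 HK ltac:(lra) ltac:(lia)).
  rewrite Nat.add_succ_r; simpl in H1 |- *; lra.
Qed.

(** The five successive ratios are at least [K ^ 4], [K ^ 3], [K ^ 2], [K] and 1, and
    [4 + 3 + 2 + 1 = 10]. *)
Lemma term_five_below (K r : R) (j : nat) :
  1 < K -> K ^ (j + 5) <= r -> term K r j * K ^ 10 <= term K r (j + 5).
Proof.
intros HK Hr.
assert (H0 := term_grows K r (j + 5) j 4 HK Hr ltac:(lia)).
assert (H1 := term_grows K r (j + 5) (S j) 3 HK Hr ltac:(lia)).
assert (H2 := term_grows K r (j + 5) (S (S j)) 2 HK Hr ltac:(lia)).
assert (H3 := term_grows K r (j + 5) (S (S (S j))) 1 HK Hr ltac:(lia)).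
assert (H4 := term_grows K r (j + 5) (S (S (S (S j)))) 0 HK Hr ltac:(lia)).
replace (j + 5)%nat with (S (S (S (S (S j))))) by lia.
replace (K ^ 10) with (K ^ 4 * K ^ 3 * K ^ 2 * K ^ 1) by ring.
apply (Rmult_le_compat_r (K ^ 3)) in H0; [|apply pow_le; lra].
assert (H5 : term K r j * K ^ 4 * K ^ 3 * K ^ 2 <= term K r (S (S j)) * K ^ 2).
{ apply Rmult_le_compat_r; [apply pow_le; lra|lra]. }
assert (H6 : term K r j * K ^ 4 * K ^ 3 * K ^ 2 * K ^ 1
             <= term K r (S (S (S j))) * K ^ 1).
{ apply Rmult_le_compat_r; [apply pow_le; lra|lra]. }
simpl (K ^ 0) in H4; lra.
Qed.

Lemma term_five_above (K r : R) (n : nat) :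
  1 < K -> 0 < r <= K ^ S n -> term K r (n + 5) * K ^ 10 <= term K r n.
Proof.
intros HK Hr.
assert (H0 := term_decays K r n (S (S (S (S n)))) 4 HK Hr ltac:(lia)).
assert (H1 := term_decays K r n (S (S (S n))) 3 HK Hr ltac:(lia)).
assert (H2 := term_decays K r n (S (S n)) 2 HK Hr ltac:(lia)).
assert (H3 := term_decays K r n (S n) 1 HK Hr ltac:(lia)).
assert (H4 := term_decays K r n n 0 HK Hr ltac:(lia)).
replace (n + 5)%nat with (S (S (S (S (S n))))) by lia.
replace (K ^ 10) with (K ^ 4 * K ^ 3 * K ^ 2 * K ^ 1) by ring.
set (t := term K r) in *.
assert (H5 : t (S (S (S (S (S n))))) * K ^ 4 * K ^ 3 * K ^ 2
             <= t (S (S (S n))) * K ^ 2).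
{ apply Rmult_le_compat_r; [apply pow_le; lra|].
  apply Rle_trans with (2 := H1), Rmult_le_compat_r; [apply pow_le; lra|lra]. }
assert (H6 : t (S (S (S (S (S n))))) * K ^ 4 * K ^ 3 * K ^ 2 * K ^ 1
             <= t (S (S n)) * K ^ 1).
{ apply Rmult_le_compat_r; [apply pow_le; lra|lra]. }
simpl (K ^ 0) in H4; lra.
Qed.

(* The hypothesis on [d] says that it dominates the sum of the geometric series
   of ratio [K ^ (-5)]. *)
Lemma head_bound (K r d : R) (u : nat -> C) (n j : nat) :
  1 < K -> 0 <= d -> 1 + d / K ^ 5 <= d -> K ^ n <= r ->
  (forall k, Cmod (u k) = term K r k) -> (j + 5 <= n)%nat ->
  Cmod (Csum u (S j)) <= d * term K r j.
Proof.
intros HK Hd0 Hd Hr Hu Hj.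
assert (HK5 : 0 < K ^ 5) by (apply pow_lt; lra).
assert (Hr0 : 0 < r) by (apply Rlt_le_trans with (2 := Hr), pow_lt; lra).
assert (Hd1 : 1 <= d).
{ apply Rle_trans with (2 := Hd).
  assert (0 <= d / K ^ 5) by (apply Rmult_le_pos; [|left; apply Rinv_0_lt_compat]; lra).
  lra. }
induction j as [|j IH].
- cbn [Csum]; rewrite Cplus_0_l, Hu.
  assert (H := term_pos K r 0 ltac:(lra) Hr0); nra.
- change (Csum u (S (S j))) with (Csum u (S j) + u (S j))%C.
  apply Rle_trans with (1 := Cmod_triangle _ _); rewrite Hu.
  specialize (IH ltac:(lia)).
  assert (H1 := term_grows K r n j 5 HK Hr ltac:(lia)).
  assert (H2 : term K r j <= term K r (S j) / K ^ 5).
  { apply Rmult_le_reg_r with (1 := HK5); unfold Rdiv.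
    rewrite Rmult_assoc, Rinv_l; lra. }
  assert (H3 := term_pos K r (S j) ltac:(lra) Hr0).
  apply Rle_trans with ((1 + d / K ^ 5) * term K r (S j)); [|nra].
  replace ((1 + d / K ^ 5) * term K r (S j))
    with (d * (term K r (S j) / K ^ 5) + term K r (S j)) by (field; lra).
  nra.
Qed.

(** The summand [d * term K r (N + i)] is a reserve for the terms not yet added; each new term is
    paid out of it, which carries the induction on [i]. *)
Lemma tail_bound (K r d : R) (u : nat -> C) (n N i : nat) :
  1 < K -> 0 <= d -> 1 + d / K ^ 5 <= d -> 0 < r <= K ^ S n ->
  (forall k, Cmod (u k) = term K r k) -> (n + 5 <= N)%nat ->
  Cmod (Csum (fun k => u (N + k)%nat) i) + d * term K r (N + i)
  <= d * term K r N.
Proof.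
intros HK Hd0 Hd Hr Hu HN.
assert (HK5 : 0 < K ^ 5) by (apply pow_lt; lra).
induction i as [|i IH].
- rewrite Nat.add_0_r; simpl; rewrite Cmod_0; lra.
- cbn [Csum]; apply Rle_trans with (2 := IH).
  assert (H0 := Cmod_triangle (Csum (fun k => u (N + k)%nat) i) (u (N + i)%nat)).
  rewrite Hu in H0.
  assert (H1 := term_decays K r n (N + i) 5 HK Hr ltac:(lia)).
  assert (H2 : term K r (S (N + i)) <= term K r (N + i) / K ^ 5).
  { apply Rmult_le_reg_r with (1 := HK5); unfold Rdiv.
    rewrite (Rmult_assoc _ (/ _)), Rinv_l; lra. }
  assert (H3 := term_pos K r (N + i) ltac:(lra) ltac:(lra)).
  rewrite Nat.add_succ_r.
  assert (H4 : term K r (N + i) + d * term K r (S (N + i)) <= d * term K r (N + i)).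
  { apply Rle_trans with ((1 + d / K ^ 5) * term K r (N + i)); [|nra].
    replace ((1 + d / K ^ 5) * term K r (N + i))
      with (d * (term K r (N + i) / K ^ 5) + term K r (N + i)) by (field; lra).
    nra. }
  lra.
Qed.

Lemma Cmod_Keps_term (K : R) (eps z : C) (k : nat) :
  0 < K -> Cmod eps = 1 ->
  Cmod (coef_Keps K eps k * z ^ k) = term K (Cmod z) k.
Proof.
intros HK He; now rewrite Cmod_mult, Cmod_pow, Cmod_coef_Keps.
Qed.

(** Head and tail both begin five indices away from the maximal term, hence a factor [K ^ (-10)],
    and [d] covers the geometric decay beyond. *)
Lemma f_Keps_central_approx (K d : R) (eps z : C) (m : nat) :
  1 < K -> Cmod eps = 1 -> 0 <= d -> 1 + d / K ^ 5 <= d ->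
  K ^ (m + 4) <= Cmod z <= K ^ S (m + 4) ->
  Cmod (f_Keps K eps z
        - Csum (fun k => coef_Keps K eps (m + k) * z ^ (m + k))%C 9)
  <= 2 * d / K ^ 10 * term K (Cmod z) (m + 4).
Proof.
intros HK He Hd0 Hd Hz.
set (r := Cmod z) in *.
assert (HK10 : 0 < K ^ 10) by (apply pow_lt; lra).
assert (Hr0 : 0 < r) by (apply Rlt_le_trans with (2 := proj1 Hz), pow_lt; lra).
set (u := fun k => (coef_Keps K eps k * z ^ k)%C).
assert (Hu : forall k, Cmod (u k) = term K r k).
{ intros k; apply Cmod_Keps_term; [lra|exact He]. }
assert (Htn := term_pos K r (m + 4) ltac:(lra) Hr0).
assert (Hhead : Cmod (Csum u m) <= d * (term K r (m + 4) / K ^ 10)).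
{ destruct m as [|j].
  - simpl Csum; rewrite Cmod_0; apply Rmult_le_pos; [lra|].
    left; now apply Rdiv_lt_0_compat.
  - replace (S j + 4)%nat with (j + 5)%nat in * by lia.
    apply Rle_trans with (d * term K r j).
    { now apply head_bound with (n := (j + 5)%nat). }
    apply Rmult_le_compat_l; [exact Hd0|].
    apply Rmult_le_reg_r with (1 := HK10); unfold Rdiv.
    rewrite Rmult_assoc, Rinv_l, Rmult_1_r by lra.
    now apply term_five_below. }
apply series_remainder_le with (u := u) (N := (m + 9)%nat).
- apply power_series_is_series, f_Keps_expansion; assumption.
- intros i; rewrite !Csum_add; fold u.
  set (mid := Csum (fun k => u (m + k)%nat) 9).
  change (Csum (fun k => coef_Keps K eps (m + k) * z ^ (m + k))%C 9) with mid.
  set (tl := Csum _ i).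
  replace (Csum u m + mid + tl - mid)%C with (Csum u m + tl)%C by ring.
  apply Rle_trans with (1 := Cmod_triangle _ _).
  assert (Htl : Cmod tl <= d * (term K r (m + 4) / K ^ 10)).
  { assert (H := tail_bound K r d u (m + 4) (m + 9) i HK Hd0 Hd ltac:(lra) Hu
                   ltac:(lia)); fold tl in H.
    assert (H1 := term_pos K r (m + 9 + i) ltac:(lra) Hr0).
    apply Rle_trans with (d * term K r (m + 9)); [nra|].
    apply Rmult_le_compat_l; [exact Hd0|].
    apply Rmult_le_reg_r with (1 := HK10); unfold Rdiv.
    rewrite Rmult_assoc, Rinv_l, Rmult_1_r by lra.
    replace (m + 9)%nat with (m + 4 + 5)%nat by lia.
    apply term_five_above; lra. }
  replace (2 * d / K ^ 10 * term K r (m + 4))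
    with (d * (term K r (m + 4) / K ^ 10) + d * (term K r (m + 4) / K ^ 10))
    by (field; lra).
  lra.
Qed.

Lemma central_terms_bound (K c : R) (eps z : C) (m : nat) :
  1 < K -> Cmod eps = 1 ->
  (forall t : R, -2 <= t <= 2 -> Cmod (cos_sum (eps / K) t) <= c) ->
  K ^ (m + 4) <= Cmod z <= K ^ S (m + 4) ->
  Cmod (Csum (fun k => coef_Keps K eps (m + k) * z ^ (m + k))%C 9)
  <= (c + / K ^ 10) * term K (Cmod z) (m + 4).
Proof.
intros HK He Hc Hz.
assert (Hq := Cmod_eps_div_K K eps ltac:(lra) He).
assert (HKm : 0 < K ^ m) by (apply pow_lt; lra).
pose (v := ((eps / K) ^ m * z)%C).
assert (Hv : Cmod v = Cmod z / K ^ m).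
{ unfold v; rewrite Cmod_mult, Cmod_pow, Hq, pow_inv; field; lra. }
assert (Hv2 : K ^ 4 <= Cmod v <= K ^ 5).
{ rewrite pow_add in Hz; replace (S (m + 4)) with (m + 5)%nat in Hz by lia.
  rewrite pow_add in Hz; rewrite Hv; split;
    apply Rmult_le_reg_r with (1 := HKm); unfold Rdiv;
    rewrite Rmult_assoc, Rinv_l; lra. }
rewrite (Csum_ext _ (fun k =>
   coef_Keps K eps m * z ^ m * (coef_Keps K eps k * v ^ k))%C).
2:{ intros k _; unfold v; rewrite coef_Keps_add by lra.
    rewrite (Cpow_mult_l _ z), Cpow_add_r; ring. }
rewrite Csum_scal, Cmod_mult, Cmod_Keps_term by (lra || exact He).
assert (H := nine_terms_bound K c eps v HK He Hc Hv2).
set (r := Cmod z) in *.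
assert (Hr0 : 0 < r) by (apply Rlt_le_trans with (2 := proj1 Hz), pow_lt; lra).
assert (Ht := term_pos K r m ltac:(lra) Hr0).
apply (Rmult_le_compat_l (term K r m)) in H; [|lra].
apply Rle_trans with (1 := H), Req_le; rewrite Hv.
assert (Hx : forall k, 0 < K ^ k) by (intros; apply pow_lt; lra).
(* As [|v| = r / K ^ m], the normalization [K ^ (-10) |v| ^ 4] of the nine-term bound turns the term
   of index [m] into that of index [m + 4]. *)
assert (Hadd : term K r (m + 4) = term K r m * (r / K ^ m) ^ 4 * / K ^ 10).
{ unfold term.
  assert (H1 := Cmod_coef_Keps K eps (m + 4) ltac:(lra) He).
  rewrite <- H1, coef_Keps_add, !Cmod_mult, !Cmod_pow, Hq by lra.
  rewrite !Cmod_coef_Keps by (lra || exact He).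
  change (4 * (4 + 1) / 2)%nat with 10%nat.
  rewrite !pow_inv, pow_add.
  assert (H2 := Hx (m * (m + 1) / 2)%nat); field; lra. }
rewrite Hadd; ring.
Qed.

(** Cauchy's estimate for the middle coefficient after dividing by [z ^ m]; it will show that the
    maximum modulus is positive. *)
Lemma central_terms_lower (K M : R) (eps : C) (r : R) (m : nat) :
  1 < K -> Cmod eps = 1 -> 0 < r ->
  (forall z, Cmod z = r ->
     Cmod (Csum (fun k => coef_Keps K eps (m + k) * z ^ (m + k))%C 9) <= M) ->
  term K r (m + 4) <= M.
Proof.
intros HK He Hr H.
assert (Hrm : 0 < r ^ m) by now apply pow_lt.
assert (Hc : Cmod (coef_Keps K eps (m + 4)) * r ^ 4 <= M / r ^ m).
{ apply (coef_bound 9 (fun k => coef_Keps K eps (m + k))); [exact Hr| |lia].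
  intros z Hz; specialize (H z Hz).
  rewrite (Csum_ext _ (fun k => z ^ m * (coef_Keps K eps (m + k) * z ^ k))%C) in H.
  2:{ intros k _; rewrite Cpow_add_r; ring. }
  rewrite Csum_scal, Cmod_mult, Cmod_pow, Hz in H.
  apply Rmult_le_reg_l with (1 := Hrm).
  replace (r ^ m * (M / r ^ m)) with M by (field; lra); exact H. }
apply (Rmult_le_compat_l (r ^ m)) in Hc; [|lra].
replace (r ^ m * (M / r ^ m)) with M in Hc by (field; lra).
unfold term; rewrite <- (Cmod_coef_Keps K eps) by (lra || exact He).
rewrite pow_add; lra.
Qed.

(** * Ratio of maximal term and maximum modulus *)

(** A member and an upper bound make the supremum finite, so [real] does not fall back on its
    default value; attainment of the maximum modulus is thus bypassed. *)
Lemma max_of_bounds (E : R -> Prop) (x M : R) :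
  E x -> (forall y, E y -> y <= M) -> x <= max_of E <= M.
Proof.
intros Hx HM; unfold max_of.
destruct (Lub_Rbar_correct E) as [Hub Hlub].
assert (H1 := Hub x Hx).
assert (H2 := Hlub (Finite M) (fun y Hy => HM y Hy)).
destruct (Lub_Rbar E) as [l| |]; simpl in *; tauto || lra.
Qed.

Lemma archimedean_pow (K r : R) :
  1 < K -> 1 <= r -> exists n, K ^ n <= r < K ^ S n.
Proof.
intros HK Hr.
assert (HN : exists N, r < K ^ N).
{ destruct (Pow_x_infinity K) with (b := r + 1) as [N HN].
  - rewrite Rabs_pos_eq; lra.
  - exists N; specialize (HN N (le_n N)).
    rewrite Rabs_pos_eq in HN by (apply pow_le; lra); lra. }
destruct HN as [N HN]; induction N as [|N IH]; [simpl in HN; lra|].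
destruct (Rle_or_lt (K ^ N) r) as [H|H]; [now exists N|now apply IH].
Qed.

Lemma ratio_lower_bound (K c d C1 : R) (eps : C) (r : R) :
  1 < K -> Cmod eps = 1 -> 0 <= d -> 1 + d / K ^ 5 <= d ->
  2 * d / K ^ 10 < 1 -> c + (1 + 2 * d) / K ^ 10 <= C1 ->
  (forall t : R, -2 <= t <= 2 -> Cmod (cos_sum (eps / K) t) <= c) ->
  K ^ 4 <= r ->
  / C1 <= max_term r (f_Keps K eps) / max_modulus r (f_Keps K eps).
Proof.
intros HK He Hd0 Hd Hd2 HC1 Hc Hr.
assert (H1r : 1 <= r).
{ apply Rle_trans with (2 := Hr), pow_R1_Rle; lra. }
destruct (archimedean_pow K r HK H1r) as [n Hn].
(* The condition [K ^ 4 <= r] leaves room for four terms below the maximal one. *)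
assert (Hn4 : (4 <= n)%nat).
{ apply Nat.nlt_ge; intros H.
  assert (K ^ S n <= K ^ 4) by (apply Rle_pow; [lra|lia]); lra. }
replace n with (n - 4 + 4)%nat in Hn by lia; set (m := (n - 4)%nat) in *.
assert (Hn' : K ^ (m + 4) <= r <= K ^ S (m + 4)) by lra; clear Hn.
assert (Htn := term_pos K r (m + 4) ltac:(lra) ltac:(lra)).
set (mu := term K r (m + 4)) in *.
assert (Hmu : max_term r (f_Keps K eps) = mu).
{ assert (Hcoef : forall k, Cmod (taylor_coef (f_Keps K eps) k) * r ^ k = term K r k).
  { intros k; rewrite (taylor_coef_eq _ _ (f_Keps_expansion K eps HK He)).
    now rewrite Cmod_coef_Keps by (lra || exact He). }
  apply max_of_eq.
  - exists (m + 4)%nat; now rewrite Hcoef.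
  - intros x [k ->]; rewrite Hcoef; now apply term_max. }
pose (mid := fun z => Csum (fun k => coef_Keps K eps (m + k) * z ^ (m + k))%C 9).
assert (Happ : forall z, Cmod z = r ->
  Cmod (f_Keps K eps z - mid z) <= 2 * d / K ^ 10 * mu).
{ intros z Hz; unfold mu; rewrite <- Hz; apply f_Keps_central_approx; rewrite ?Hz;
    assumption. }
assert (Hup : forall z, Cmod z = r -> Cmod (f_Keps K eps z) <= C1 * mu).
{ intros z Hz; assert (H1 := Happ z Hz).
  assert (H2 : Cmod (mid z) <= (c + / K ^ 10) * mu).
  { unfold mu; rewrite <- Hz; apply central_terms_bound; rewrite ?Hz; assumption. }
  replace (f_Keps K eps z) with ((f_Keps K eps z - mid z) + mid z)%C by ring.
  apply Rle_trans with (1 := Cmod_triangle _ _).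
  apply Rle_trans with ((c + (1 + 2 * d) / K ^ 10) * mu).
  - replace ((1 + 2 * d) / K ^ 10) with (/ K ^ 10 + 2 * d / K ^ 10)
      by (unfold Rdiv; ring); lra.
  - apply Rmult_le_compat_r; lra. }
assert (Hbd : forall z, Cmod z = r ->
  Cmod (f_Keps K eps z) <= max_modulus r (f_Keps K eps) <= C1 * mu).
{ intros z Hz; apply max_of_bounds.
  - now exists z.
  - intros y [w [Hw ->]]; now apply Hup. }
set (M := max_modulus r (f_Keps K eps)) in *.
(* Positivity makes the final division legitimate: the central terms reach at least [mu] on the
   circle, while the remainder stays strictly below [mu]. *)
assert (HM : 0 < M).
{ assert (H : mu <= M + 2 * d / K ^ 10 * mu).
  { apply central_terms_lower with (eps := eps); [exact HK|exact He|lra|].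
    intros z Hz; fold (mid z).
    replace (mid z) with (f_Keps K eps z + - (f_Keps K eps z - mid z))%C by ring.
    apply Rle_trans with (1 := Cmod_triangle _ _); rewrite Cmod_opp.
    assert (H1 := Happ z Hz); assert (H2 := Hbd z Hz); lra. }
  nra. }
assert (HMle : M <= C1 * mu).
{ apply (Hbd (RtoC r)); rewrite Cmod_R, Rabs_pos_eq; lra. }
rewrite Hmu.
assert (HC : 0 < C1) by nra.
apply Rmult_le_reg_r with (C1 * M); [now apply Rmult_lt_0_compat|].
replace (/ C1 * (C1 * M)) with M by (field; lra).
replace (mu / M * (C1 * M)) with (C1 * mu) by (field; lra); exact HMle.
Qed.

Lemma Rbar_lub_ge (E : Rbar -> Prop) (l : Rbar) : E l -> Rbar_le l (Rbar_lub E).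
Proof.
intros Hl; unfold Rbar_lub; destruct (Rbar_ex_lub E) as [m [Hub Hleast]]; now apply Hub.
Qed.

Lemma LimInf_p_infty_ge (g : R -> R) (A l : R) :
  (forall r, A < r -> l <= g r) -> Rbar_le l (LimInf_p_infty g).
Proof.
intros H; unfold LimInf_p_infty.
apply Rbar_le_trans with (Glb_Rbar (fun y => exists r : R, A < r /\ y = g r)).
2:{ apply Rbar_lub_ge; now exists A. }
apply (proj2 (Glb_Rbar_correct (fun y => exists r : R, A < r /\ y = g r))).
intros y [r [Hr ->]]; simpl; now apply H.
Qed.

(** * Transcendence *)

(** Polynomial coefficients padded with zeros would form a second expansion, contradicting
    uniqueness at index [N + 1], where [coef_Keps] is nonzero. *)
Lemma f_Keps_not_polynomial (K : R) (eps : C) :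
  1 < K -> Cmod eps = 1 -> ~ polynomial_function (f_Keps K eps).
Proof.
intros HK He [N [c Hc]].
pose (c' := fun k => if (k <=? N)%nat then c k else RtoC 0).
assert (Hexp : is_expansion (f_Keps K eps) c').
{ intros z; unfold is_power_series, is_pseries, is_series.
  apply filterlim_ext_loc with (fun _ : nat => f_Keps K eps z).
  2:{ apply filterlim_const. }
  exists N; intros n Hn; rewrite Hc.
  induction n as [|n IH].
  - replace N with O by lia; rewrite !sum_O; unfold c'; simpl.
    change ((c O * 1)%C = (1 * c O)%C); ring.
  - destruct (Nat.eq_dec N (S n)) as [->|HN].
    + apply sum_n_ext_loc; intros k Hk; unfold c'.
      rewrite (proj2 (Nat.leb_le _ _) Hk).
      apply Cmult_comm.
    + rewrite sum_Sn, <- IH by lia; unfold c' at 1.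
      rewrite (proj2 (Nat.leb_gt _ _)) by lia.
      symmetry; refine (eq_trans (f_equal _ (Cmult_0_r _)) (Cplus_0_r _)). }
assert (H := is_expansion_unique _ _ _ Hexp (f_Keps_expansion K eps HK He) (S N)).
unfold c' in H; rewrite (proj2 (Nat.leb_gt _ _)) in H by lia.
apply (f_equal Cmod) in H; rewrite Cmod_0, Cmod_coef_Keps in H by (lra || exact He).
assert (0 < / K ^ (S N * (S N + 1) / 2)) by (apply Rinv_0_lt_compat, pow_lt; lra).
lra.
Qed.

(** * Complex differentiability of the sum *)

(** Real part of the expansion already established, taken at [eps = 1] and a real point. *)
Lemma ex_series_term (K r : R) : 1 < K -> ex_series (term K r).
Proof.
intros HK.
assert (H := f_Keps_expansion K 1 HK Cmod_1 (RtoC r)).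
destruct (is_power_series_real _ _ _ H) as [H1 _].
exists (fst (f_Keps K 1 (RtoC r))).
refine (is_series_ext _ _ _ _ H1); intros n; unfold coef_Keps, term.
rewrite Cpow_1_l, pow_n_pow.
assert (0 < K ^ (n * (n + 1) / 2)) by (apply pow_lt; lra).
change (r ^ n * fst (1 / RtoC (K ^ (n * (n + 1) / 2)))%C
        = / K ^ (n * (n + 1) / 2) * r ^ n).
rewrite <- RtoC_div by lra; unfold RtoC, fst; field; lra.
Qed.

Lemma Cmod_Csum_le_Series (u : nat -> C) (v : nat -> R) (n : nat) :
  (forall k, Cmod (u k) <= v k) -> ex_series v -> Cmod (Csum u n) <= Series v.
Proof.
intros Huv Hv.
assert (Hv0 : forall k, 0 <= v k).
{ intros k; apply Rle_trans with (2 := Huv k), Cmod_ge_0. }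
(* [sum_n v n] has [n + 1] terms, so the induction runs on [Csum u (S n)]. *)
assert (Hle : Cmod (Csum u (S n)) <= sum_n v n /\ Cmod (Csum u n) <= sum_n v n).
{ induction n as [|n [IH1 IH2]].
  - rewrite sum_O; cbn [Csum]; rewrite Cplus_0_l, Cmod_0; split; [apply Huv|apply Hv0].
  - rewrite sum_Sn; change (plus (sum_n v n) (v (S n))) with (sum_n v n + v (S n)).
    split; [|specialize (Hv0 (S n)); lra].
    change (Csum u (S (S n))) with (Csum u (S n) + u (S n))%C.
    apply Rle_trans with (1 := Cmod_triangle _ _); specialize (Huv (S n)); lra. }
apply Rle_trans with (1 := proj2 Hle).
apply (is_lim_seq_incr_compare (sum_n v)).
- apply Series_correct in Hv; exact Hv.
- intros k; rewrite sum_Sn; specialize (Hv0 (S k)).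
  change (plus (sum_n v k) (v (S k))) with (sum_n v k + v (S k)); lra.
Qed.

Lemma INR_le_pow2 (n : nat) : INR n <= 2 ^ n.
Proof.
induction n as [|n IH]; [simpl; lra|].
rewrite S_INR; simpl.
assert (1 <= 2 ^ n) by (apply pow_R1_Rle; lra); lra.
Qed.

(** Deliberately crude: the series of derivatives and that of remainders get the same majorant
    [term K (2 * s)]. *)
Lemma pow_derivative_bound (x s : R) (n : nat) :
  0 <= x <= s -> 1 <= s -> INR n * x ^ (n - 1) <= (2 * s) ^ n.
Proof.
intros Hx Hs; rewrite Rpow_mult_distr; apply Rmult_le_compat.
- apply pos_INR.
- apply pow_le; lra.
- apply INR_le_pow2.
- apply Rle_trans with (s ^ (n - 1)).
  + now apply pow_incr.
  + apply Rle_pow; [exact Hs|lia].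
Qed.

(** The remainder of order [n + 1] is [z + h] times that of order [n], plus [h ^ 2] times the
    derivative of the power; the constants add up because [s + 1 <= 2 s]. *)
Lemma Cpow_taylor_remainder (s : R) (z h : C) (n : nat) :
  1 <= s -> Cmod z <= s -> Cmod (z + h) <= s ->
  Cmod ((z + h) ^ n - z ^ n - h * (INR n * z ^ (n - 1))) <= (2 * s) ^ n * Cmod h ^ 2.
Proof.
intros Hs Hz Hzh.
assert (Hh : 0 <= Cmod h ^ 2) by apply pow2_ge_0.
induction n as [|n IH].
- simpl Cpow; simpl INR.
  replace (1 - 1 - h * (0 * 1))%C with (RtoC 0) by ring.
  rewrite Cmod_0; simpl; lra.
- replace ((z + h) ^ S n - z ^ S n - h * (INR (S n) * z ^ (S n - 1)))%C
    with ((z + h) * ((z + h) ^ n - z ^ n - h * (INR n * z ^ (n - 1)))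
          + h ^ 2 * (INR n * z ^ (n - 1)))%C.
  2:{ rewrite S_INR, RtoC_plus; destruct n as [|n].
      - simpl; ring.
      - replace (S (S n) - 1)%nat with (S n) by lia.
        replace (S n - 1)%nat with n by lia; rewrite !Cpow_S; ring. }
  apply Rle_trans with (1 := Cmod_triangle _ _).
  rewrite !Cmod_mult, !Cmod_pow, Cmod_R, Rabs_pos_eq by apply pos_INR.
  assert (Hp : 0 < (2 * s) ^ n) by (apply pow_lt; lra).
  assert (H1 := pow_derivative_bound (Cmod z) s n (conj (Cmod_ge_0 z) Hz) Hs).
  assert (H2 : Cmod (z + h) * Cmod ((z + h) ^ n - z ^ n - h * (INR n * z ^ (n - 1)))
               <= s * ((2 * s) ^ n * Cmod h ^ 2)).
  { apply Rmult_le_compat; try apply Cmod_ge_0; assumption. }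
  assert (H3 : Cmod h ^ 2 * (INR n * Cmod z ^ (n - 1)) <= Cmod h ^ 2 * (2 * s) ^ n)
    by (apply Rmult_le_compat_l; assumption).
  rewrite <- (tech_pow_Rmult (2 * s) n).
  assert (0 <= (2 * s) ^ n * Cmod h ^ 2) by (apply Rmult_le_pos; lra).
  nra.
Qed.

(** Termwise differentiation: [g] sums the derivatives, and the quadratic remainders sum to at most
    [|h| ^ 2 S0]. *)
Lemma f_Keps_entire (K : R) (eps : C) :
  1 < K -> Cmod eps = 1 -> entire (f_Keps K eps).
Proof.
intros HK He z.
pose (s := Cmod z + 1).
assert (Hs : 1 <= s) by (unfold s; pose proof (Cmod_ge_0 z); lra).
pose (a := coef_Keps K eps).
pose (v := fun n => (a n * (INR n * z ^ (n - 1)))%C).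
assert (Ha : forall n (x : C) B, Cmod x <= B * (2 * s) ^ n ->
  Cmod (a n * x) <= B * term K (2 * s) n).
{ intros n x B0 Hx; unfold term, a.
  rewrite Cmod_mult, Cmod_coef_Keps by (lra || exact He).
  replace (B0 * (/ K ^ (n * (n + 1) / 2) * (2 * s) ^ n))
    with (/ K ^ (n * (n + 1) / 2) * (B0 * (2 * s) ^ n)) by ring.
  apply Rmult_le_compat_l; [|exact Hx].
  left; apply Rinv_0_lt_compat, pow_lt; lra. }
assert (Hex : ex_series (term K (2 * s))) by now apply ex_series_term.
assert (Hv : @ex_series C_AbsRing C_NormedModule v).
{ apply (@ex_series_le C_AbsRing C_CompleteNormedModule) with (term K (2 * s));
    [|exact Hex].
  intros n; change (Cmod (v n) <= term K (2 * s) n).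
  rewrite <- (Rmult_1_l (term _ _ _)); apply Ha.
  rewrite Cmod_mult, Cmod_pow, Cmod_R, Rabs_pos_eq by apply pos_INR.
  rewrite Rmult_1_l; apply pow_derivative_bound; [|exact Hs].
  split; [apply Cmod_ge_0|unfold s; lra]. }
destruct Hv as [g Hg].
set (S0 := Series (term K (2 * s))).
assert (HS0 : 0 <= S0).
{ apply Rle_trans with (2 := Cmod_Csum_le_Series (fun _ => RtoC 0) _ 0
    (fun k => Rle_trans _ _ _ (Req_le _ _ Cmod_0)
       (Rlt_le _ _ (term_pos K (2 * s) k ltac:(lra) ltac:(lra)))) Hex).
  apply Cmod_ge_0. }
assert (Hrem : forall h, Cmod h <= 1 ->
  Cmod (f_Keps K eps (z + h) - f_Keps K eps z - h * g) <= Cmod h ^ 2 * S0).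
{ intros h Hh.
  assert (Hzh : Cmod (z + h) <= s).
  { apply Rle_trans with (1 := Cmod_triangle _ _); unfold s; lra. }
  assert (H1 := power_series_is_series _ _ _ (f_Keps_expansion K eps HK He (z + h)%C)).
  assert (H0 := power_series_is_series _ _ _ (f_Keps_expansion K eps HK He z)).
  assert (H2 := is_series_minus _ _ _ _ (is_series_minus _ _ _ _ H1 H0)
                  (is_series_scal h _ _ Hg)).
  replace (f_Keps K eps (z + h) - f_Keps K eps z - h * g)%C
    with (f_Keps K eps (z + h) - f_Keps K eps z - h * g - 0)%C by ring.
  apply (series_remainder_le _ _ 0 _ O H2); intros i; rewrite Nat.add_0_l.
  unfold S0; rewrite <- Series_scal_l; unfold Cminus at 1.
  rewrite Copp_0, Cplus_0_r; apply Cmod_Csum_le_Series.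
  - intros n.
    change (Cmod ((a n * (z + h) ^ n - a n * z ^ n)
                  - h * (a n * (INR n * z ^ (n - 1))))
            <= Cmod h ^ 2 * term K (2 * s) n).
    replace ((a n * (z + h) ^ n - a n * z ^ n) - h * (a n * (INR n * z ^ (n - 1))))%C
      with (a n * ((z + h) ^ n - z ^ n - h * (INR n * z ^ (n - 1))))%C by ring.
    apply Ha; rewrite Rmult_comm; apply Cpow_taylor_remainder; unfold s in *; lra.
  - exact (@ex_series_scal R_AbsRing R_NormedModule (Cmod h ^ 2) _ Hex). }
exists g; split.
- apply is_linear_scal_l.
- intros x Hx.
  apply (@is_filter_lim_locally_unique C_AbsRing (AbsRing_NormedModule C_AbsRing))
    in Hx; subst x.
  intros e.
  apply (@locally_le_locally_norm C_AbsRing (AbsRing_NormedModule C_AbsRing)).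
  (* The radius 1 keeps [z + h] in the disk of radius [s]; adding 1 to [S0] keeps the denominator
     positive. *)
  assert (He0 : 0 < Rmin 1 (e / (S0 + 1))).
  { apply Rmin_pos; [lra|]; apply Rdiv_lt_0_compat; [apply cond_pos|lra]. }
  exists (mkposreal _ He0); intros y Hy.
  change (Cmod (y - z) < Rmin 1 (e / (S0 + 1))) in Hy.
  change (Cmod (f_Keps K eps y - f_Keps K eps z - (y - z) * g) <= e * Cmod (y - z)).
  set (h := (y - z)%C) in *.
  assert (Hh1 := Rlt_le_trans _ _ _ Hy (Rmin_l _ _)).
  assert (Hh2 := Rlt_le_trans _ _ _ Hy (Rmin_r _ _)).
  replace y with (z + h)%C by (unfold h; ring).
  apply Rle_trans with (1 := Hrem h (Rlt_le _ _ Hh1)).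
  apply (Rmult_lt_compat_r (S0 + 1)) in Hh2; [|lra].
  replace (e / (S0 + 1) * (S0 + 1)) with (pos e) in Hh2 by (field; lra).
  assert (H0 := Cmod_ge_0 h).
  replace (Cmod h ^ 2 * S0) with (Cmod h * S0 * Cmod h) by ring.
  apply Rmult_le_compat_r; [exact H0|nra].
Qed.

(** * Choice of the parameters and conclusion *)

Theorem theorem1p2 :
  (exists (K0 : R) (eps0 : C),
      1 < K0 /\ Cmod eps0 = 1 /\
      transcendental_entire (f_Keps K0 eps0) /\
      Rbar_lt (58507 / 100000) (beta (f_Keps K0 eps0))) /\
  Rbar_lt (58507 / 100000) B.
Proof.
assert (H : exists (K0 : R) (eps0 : C),
      1 < K0 /\ Cmod eps0 = 1 /\
      transcendental_entire (f_Keps K0 eps0) /\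
      Rbar_lt (58507 / 100000) (beta (f_Keps K0 eps0))).
(* This is [1 / |q0|], as [41 ^ 2 + 44 ^ 2 = 3617] and [214 ^ 2 = 45796]; hence [q0 K] has modulus
   1. *)
{ pose (K := sqrt (45796 / 3617)).
  assert (HK2 : K ^ 2 = 45796 / 3617) by (simpl; rewrite Rmult_1_r; apply sqrt_sqrt; lra).
  assert (HK0 : 0 <= K) by apply sqrt_pos.
  assert (HK : 1 < K) by nra.
  assert (HKC : RtoC K <> 0%C) by (intros E; apply RtoC_inj in E; lra).
  assert (HK5 : 501 <= K ^ 5).
  { replace (K ^ 5) with ((K ^ 2) ^ 2 * K) by ring; rewrite HK2.
    assert (3.55 < K) by nra; lra. }
  assert (HK10 : K ^ 10 = (45796 / 3617) ^ 5) by (rewrite <- HK2; ring).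
  pose (eps := (q0 * K)%C).
  assert (Hq : (eps / K = q0)%C) by (unfold eps; field; exact HKC).
  assert (Heps : Cmod eps = 1).
  { unfold Cmod; rewrite <- sqrt_1; f_equal; unfold eps, q0; simpl.
    simpl in HK2; nra. }
  exists K, eps; split; [exact HK|]; split; [exact Heps|]; split.
  - split; [now apply f_Keps_entire|now apply f_Keps_not_polynomial].
  (* The inverse of 1.709197 lies just above 0.58507. *)
  - apply Rbar_lt_le_trans with (/ (1709197 / 1000000)); [simpl; lra|].
    apply LimInf_p_infty_ge with (A := K ^ 4); intros r Hr.
    (* The value [d = 1.002] solves [1 + d / 501 = d], where [501 <= K ^ 5]; the error
       [(1 + 2 d) / K ^ 10] fits between [c] and 1.709197. *)
    apply ratio_lower_bound with (c := 17091877 / 10000000) (d := 1002 / 1000);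
      try assumption; try lra.
    + assert (/ K ^ 5 <= / 501) by (apply Rinv_le_contravar; lra); lra.
    + rewrite HK10; lra.
    + rewrite HK10; lra.
    + rewrite Hq; exact cos_sum_q0_bound. }
split; [exact H|].
destruct H as [K [eps [_ [_ [Htr Hb]]]]].
apply Rbar_lt_le_trans with (1 := Hb).
apply Rbar_lub_ge; now exists (f_Keps K eps).
Qed.
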